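(* Let $K$ be a field, let $G$ be a finite simple graph on the vertex set $[n]=\{1,\dots,n\}$ with connected components $G_1,\dots,G_r$, and put $n_i=|V(G_i)|$ for $1\le i\le r$. Let $J_G\subset S=K[x_1,\dots,x_n,y_1,\dots,y_n]$ be the binomial edge ideal of $G$. Then the following conditions are equivalent: (i) $J_G$ is a lattice ideal. (ii) $J_G=\langle J_{G_1},\dots,J_{G_r}\rangle=\sum_{i=1}^r I_{K_{2,n_i}}$ and $J_{G_i}=I_{K_{2,n_i}}$ for every $i=1,\dots,r$. Here $I_{K_{2,n_i}}$ denotes the toric ideal associated to the complete bipartite graph $K_{2,n_i}$, written in the variables $x_v,y_v$ with $v\in V(G_i)$.
   Context: Binomial edge ideal: for a finite simple graph $H$ with vertex set $V(H)\subseteq[n]$, $J_H$ is the ideal generated by the binomials $x_iy_j-x_jy_i$ with $\{i,j\}\in E(H)$. All of the ideals $J_{G_i}$ and $I_{K_{2,n_i}}$ (which are generated by polynomials in the variables $x_v,y_v$, $v\in V(G_i)$) are regarded as ideals of $S=K[x_1,\dots,x_n,y_1,\dots,y_n]$ by extension, i.e. by taking the ideal they generate in $S$. Toric ideal associated to a graph: for a finite simple graph $H$ with edges $e_1,\dots,e_q$, $I_H$ is the kernel of the $K$-algebra homomorphism $K[t_1,\dots,t_q]\to K[z_v: v\in V(H)]$ sending $t_k$ to $z_uz_v$ where $e_k=\{u,v\}$. For $H=K_{2,n_i}$ with parts $\{s_1,s_2\}$ and $\{t_v : v\in V(G_i)\}$, the edge variables are named $x_v$ (for the edge $\{s_1,t_v\}$)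 and $y_v$ (for the edge $\{s_2,t_v\}$), so $I_{K_{2,n_i}}$ is the kernel of the $K$-algebra homomorphism $K[x_v,y_v: v\in V(G_i)]\to K[s_1,s_2,t_v: v\in V(G_i)]$ given by $x_v\mapsto s_1t_v$, $y_v\mapsto s_2t_v$. Lattice ideal: a partial character on $\mathbb{Z}^N$ is a group homomorphism $\rho:L_\rho\to K^\ast=K\setminus\{0\}$ from a subgroup (lattice) $L_\rho\subseteq\mathbb{Z}^N$. For $m\in\mathbb{Z}^N$ let $m_+,m_-\in\mathbb{Z}_{\ge0}^N$ be its positive and negative parts, $m=m_+-m_-$. In a polynomial ring $K[z_1,\dots,z_N]$ put $I_+(\rho)=\langle z^{m_+}-\rho(m)z^{m_-} : m\in L_\rho\rangle$. An ideal $I$ of $K[z_1,\dots,z_N]$ is a lattice ideal if $I=I_+(\rho)$ for some partial character $\rho$ on $\mathbb{Z}^N$. Here this is applied to $S$, with $N=2n$. *)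

(* Defs.v *)
From HB Require Import structures.
From mathcomp Require Import all_boot all_order all_algebra.
From mathcomp Require Import mpoly.

Set Implicit Arguments.
Unset Strict Implicit.
Unset Printing Implicit Defensive.

Import Order.TTheory GRing.Theory Num.Theory.
Local Open Scope ring_scope.

(* Ideals are Prop-valued predicates, compared extensionally. *)
Section Ideals.
Variable R : comNzRingType.
Implicit Types (A I J : R -> Prop) (f : R).

Definition ideal_eq I J : Prop := forall f, I f <-> J f.

Definition ideal_gen A : R -> Prop := fun f =>
  exists s : seq (R * R),
    (forall p, p \in s -> A p.2) /\ f = \sum_(p <- s) p.1 * p.2.

Definition ideal_sum (T : finType) (D : {set T}) (I : T -> R -> Prop) :
  R -> Prop := fun f =>
  exists g : T -> R,
    (forall t, t \in D -> I t (g t)) /\ f = \sum_(t in D) g t.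

End Ideals.

Section LatticeIdeals.
Variables (K : fieldType) (N : nat).

(* The values of [pc_val] outside the lattice [pc_dom] are irrelevant. *)
Record partial_character := PartialCharacter {
  pc_dom : 'rV[int]_N -> Prop;
  pc_val : 'rV[int]_N -> K;
  pc_dom0 : pc_dom 0;
  pc_domB : forall a b, pc_dom a -> pc_dom b -> pc_dom (a - b);
  pc_val_neq0 : forall a, pc_dom a -> pc_val a != 0;
  pc_valD : forall a b, pc_dom a -> pc_dom b ->
    pc_val (a + b) = pc_val a * pc_val b
}.

Definition mpos (m : 'rV[int]_N) : 'X_{1..N} :=
  [multinom absz (Num.max (m 0 i) 0)%R | i < N].

Definition mneg (m : 'rV[int]_N) : 'X_{1..N} :=
  [multinom absz (Num.max (- m 0 i) 0)%R | i < N].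

Definition lattice_ideal_of (rho : partial_character) :
  {mpoly K[N]} -> Prop :=
  ideal_gen (fun f => exists m : 'rV[int]_N,
    pc_dom rho m /\ f = 'X_[mpos m] - pc_val rho m *: 'X_[mneg m]).

Definition is_lattice_ideal (I : {mpoly K[N]} -> Prop) : Prop :=
  exists rho : partial_character, ideal_eq I (lattice_ideal_of rho).

End LatticeIdeals.

(* The toric ideal of a graph on ['I_p] with edges e_0, ..., e_(q-1), where
   [ends k] lists the two end points of e_k (in either order). *)
Definition toric_ideal (K : fieldType) (p q : nat)
  (ends : 'I_q -> 'I_p * 'I_p) : {mpoly K[q]} -> Prop := fun f =>
  f \mPo [tuple ('X_(ends k).1 * 'X_(ends k).2 : {mpoly K[p]}) | k < q] = 0.

Definition edge_enum (p q : nat) (e : rel 'I_p) (ends : 'I_q -> 'I_p * 'I_p) :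
  Prop :=
  [/\ forall k, e (ends k).1 (ends k).2,
      forall i j, e i j -> exists k, ends k = (i, j) \/ ends k = (j, i)
    & forall k l, ends k = ends l \/ ends k = ((ends l).2, (ends l).1) ->
        k = l].

Section CompleteBipartite.
Variable m : nat.

Definition K2_rel : rel 'I_(2 + m) :=
  [rel i j : 'I_(2 + m) | (i < 2)%N (+) (j < 2)%N].

(* The parts are {s_1, s_2} = {lshift m 0, lshift m 1} and the vertices
   t_i = rshift 2 i; edge [lshift m i] is {s_1, t_i}, edge [rshift m i] is
   {s_2, t_i}. *)
Definition K2_ends (k : 'I_(m + m)) : 'I_(2 + m) * 'I_(2 + m) :=
  match split k with
  | inl i => (lshift m (0 : 'I_2), rshift 2 i)
  | inr i => (lshift m (1 : 'I_2), rshift 2 i)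
  end.

Lemma K2_ends_enum : edge_enum K2_rel K2_ends.
Proof.
split.
- by move=> k; rewrite /K2_ends; case: (split k) => i.
- have enum2 (i : 'I_2) (j : 'I_m) :
    exists k, K2_ends k = (lshift m i, rshift 2 j).
    case: i => -[|[|//]] lti.
    + exists (lshift m j); rewrite /K2_ends (unsplitK (inl j)).
      by congr (_, _); apply: val_inj.
    + exists (rshift m j); rewrite /K2_ends (unsplitK (inr j)).
      by congr (_, _); apply: val_inj.
  move=> i j; rewrite -(splitK i) -(splitK j) /K2_rel /=.
  case: (split i) (split j) => [a|a] [b|b] /=.
  + by rewrite !ltn_ord.
  + by move=> _; have [k kE] := enum2 a b; exists k; left.
  + by move=> _; have [k kE] := enum2 b a; exists k; right.
  + by [].
- move=> k l; rewrite -(splitK k) -(splitK l) /K2_ends !unsplitK.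
  case: (split k) (split l) => [a|a] [b|b] /= [] // [] //.
  + by move=> ab; congr lshift; apply: val_inj; case: ab.
  + by move=> ab; congr rshift; apply: val_inj; case: ab.
Qed.

End CompleteBipartite.

Section BinomialEdgeIdeals.
Variables (K : fieldType) (n : nat).
Local Notation S := {mpoly K[n + n]}.

Definition xvar (v : 'I_n) : S := 'X_(lshift n v).
Definition yvar (v : 'I_n) : S := 'X_(rshift n v).

Definition binomial_edge_ideal (e : rel 'I_n) : S -> Prop :=
  ideal_gen (fun f => exists i j : 'I_n,
    e i j /\ f = xvar i * yvar j - xvar j * yvar i).

(* Vertex sets of the connected components of a symmetric relation. *)
Definition components (e : rel 'I_n) : {set {set 'I_n}} :=
  equivalence_partition (connect e) [set: 'I_n].

Definition induced (e : rel 'I_n) (C : {set 'I_n}) : rel 'I_n :=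
  [rel i j | [&& i \in C, j \in C & e i j]].

(* The names x_v, y_v (v in C) of the edge variables of K_{2,#|C|}; t_i stands
   for the vertex [enum_val i] of C. *)
Definition K2_edge_var (C : {set 'I_n}) (k : 'I_(#|C| + #|C|)) : S :=
  match split k with
  | inl i => xvar (enum_val i)
  | inr i => yvar (enum_val i)
  end.

(* The extension to S of the toric ideal of K_{2,#|C|}. *)
Definition toric_K2_ideal (C : {set 'I_n}) : S -> Prop :=
  ideal_gen (fun f => exists g : {mpoly K[#|C| + #|C|]},
    toric_ideal (@K2_ends #|C|) g /\
    f = g \mPo [tuple K2_edge_var k | k < #|C| + #|C|]).

End BinomialEdgeIdeals.

Arguments binomial_edge_ideal K {n} e _.
Arguments toric_K2_ideal K {n} C _.

(* Main.v *)
(* Both conditions say that every connected component of the graph is complete.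
   A binomial X^u - X^v lies in the lattice ideal of rho exactly when u - v is
   in the lattice and rho (u - v) = 1, so if J_G is a lattice ideal, then the
   relation x_i y_j - x_j y_i \in J_G is transitive, hence holds along every
   path; evaluation at a point with 0/1 coordinates shows that such a minor lies
   in J_G only if {i, j} is an edge.  Conversely, if the components are
   complete, exchanging x_i y_j for x_j y_i connects any two monomials with the
   same degree at each vertex and the same x-degree on each component.  This
   rearrangement identifies J_{G_i} with the toric ideal of K_{2,n_i}, and J_G
   with the lattice ideal of the trivial character. *)
From HB Require Import structures.
Require Import Defs.
From mathcomp Require Import all_boot all_order all_algebra.
From mathcomp Require Import ssrcomplements mpoly.
From mathcomp Require Import zify.
From Stdlib Require Import ClassicalEpsilon.

Set Implicit Arguments.
Unset Strict Implicit.
Unset Printing Implicit Defensive.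

Import Order.TTheory GRing.Theory Num.Theory.
Local Open Scope ring_scope.

(** * Ideals, generated ideals and sums of ideals *)

Record is_ideal (R : comNzRingType) (I : R -> Prop) : Prop := IsIdeal {
  ideal0 : I 0;
  idealD : forall a b, I a -> I b -> I (a + b);
  idealMl : forall p a, I a -> I (p * a)
}.

Section Ideals.
Variable R : comNzRingType.
Implicit Types (A I : R -> Prop) (f g : R).

Lemma ideal_bigsum I T (s : seq T) (P : pred T) (F : T -> R) : is_ideal I ->
  (forall t, P t -> I (F t)) -> I (\sum_(t <- s | P t) F t).
Proof.
by move=> idI IF; apply: big_ind IF; [apply: ideal0 | apply: idealD].
Qed.

Lemma ideal_gen_ideal A : is_ideal (ideal_gen A).
Proof.
split=> [|a b [s [sA ->]] [t [tA ->]]|p a [s [sA ->]]].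
- by exists [::]; rewrite big_nil.
- exists (s ++ t); rewrite big_cat; split=> // q.
  by rewrite mem_cat => /orP[/sA|/tA].
- exists [seq (p * q.1, q.2) | q <- s]; split=> [q /mapP[r /sA Ar ->] //|].
  by rewrite big_map mulr_sumr; apply: eq_bigr => q _; rewrite mulrA.
Qed.

Lemma ideal_gen_sub A f : A f -> ideal_gen A f.
Proof.
move=> Af; exists [:: (1, f)]; rewrite big_seq1 mul1r; split=> // p.
by rewrite inE => /eqP ->.
Qed.

Lemma ideal_gen_min A I f :
  is_ideal I -> (forall g, A g -> I g) -> ideal_gen A f -> I f.
Proof.
move=> idI AI [s [sA ->]]; rewrite big_seq; apply: ideal_bigsum => // p /sA.
by move=> /AI; apply: idealMl.
Qed.

Lemma ideal_preim (R' : comNzRingType) (h : {rmorphism R -> R'})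
    (I : R' -> Prop) : is_ideal I -> is_ideal (fun f => I (h f)).
Proof.
move=> idI; split=> [|a b Ia Ib|p a Ia]; rewrite ?(rmorph0, rmorphD, rmorphM).
- exact: ideal0.
- exact: idealD.
- exact: idealMl.
Qed.

Lemma ideal_sum_ideal (T : finType) (D : {set T}) (I : T -> R -> Prop) :
  (forall t, t \in D -> is_ideal (I t)) -> is_ideal (ideal_sum D I).
Proof.
move=> idI; split=> [|_ _ [g [Ig ->]] [h [Ih ->]]|p _ [g [Ig ->]]].
- exists (fun=> 0); rewrite big1 //; split=> // t /idI; exact: ideal0.
- exists (fun t => g t + h t); rewrite big_split; split=> // t Dt.
  by apply: idealD; [apply: idI | apply: Ig | apply: Ih].
- exists (fun t => p * g t); rewrite mulr_sumr; split=> // t Dt.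
  by apply: idealMl; [apply: idI | apply: Ig].
Qed.

Lemma ideal_sum_sub (T : finType) (D : {set T}) (I : T -> R -> Prop) t f :
  (forall t, t \in D -> is_ideal (I t)) -> t \in D -> I t f -> ideal_sum D I f.
Proof.
move=> idI Dt If; exists (fun t' => if t' == t then f else 0); split.
  by move=> t' Dt'; case: eqP => [->|_] //; apply: ideal0; apply: idI.
by rewrite (bigD1 t) //= eqxx big1 ?addr0 // => t' /andP[_ /negbTE ->].
Qed.

End Ideals.

(** * Linear extension of maps defined on monomials *)

Section LinearExtension.
Variables (n : nat) (R : comNzRingType) (V : lmodType R) (c : 'X_{1..n} -> V).

Definition monom_linext (p : {mpoly R[n]}) : V :=
  \sum_(m <- msupp p) p@_m *: c m.

(** A common size bound [k] gives polynomials with different supports the same index set; linearity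
    is then checked term by term. *)
Lemma monom_linextE k p : (msize p <= k)%N ->
  monom_linext p = \sum_(m : 'X_{1..n < k}) p@_m *: c m.
Proof.
move=> le_pk; rewrite /monom_linext (big_mksub 'X_{1..n < k}) ?msupp_uniq //=;
  last by move=> x /msize_mdeg_lt /leq_trans; apply.
by rewrite big_rmcond //= => j /memN_msupp_eq0 ->; rewrite scale0r.
Qed.

Lemma monom_linext_is_linear : linear monom_linext.
Proof.
move=> a p q; pose k := maxn (msize (a *: p + q)) (maxn (msize p) (msize q)).
rewrite !(@monom_linextE k) ?leq_max ?leqnn ?orbT //.
rewrite scaler_sumr -big_split; apply: eq_bigr => m _.
by rewrite mcoeffD mcoeffZ scalerDl scalerA.
Qed.

HB.instance Definition _ :=
  GRing.isLinear.Build R {mpoly R[n]} V _ monom_linext monom_linext_is_linear.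

Lemma monom_linextX m : monom_linext 'X_[m] = c m.
Proof. by rewrite /monom_linext msuppX big_seq1 mcoeffX eqxx scale1r. Qed.

End LinearExtension.

(** * Pure binomials in lattice ideals *)

Section LatticeIdeals.
Variables (K : fieldType) (N : nat).
Implicit Types (u v w : 'X_{1..N}) (rho : partial_character K N).

Definition mnm_diff u v : 'rV[int]_N := \row_k ((u k)%:Z - (v k)%:Z).

Lemma mnm_diff_pos u v k : (mpos (mnm_diff u v) k = u k - v k)%N.
Proof. by rewrite mnmE mxE; lia. Qed.

Lemma mnm_diff_neg u v k : (mneg (mnm_diff u v) k = v k - u k)%N.
Proof. by rewrite mnmE mxE; lia. Qed.

Lemma mnm_diff_posneg (m : 'rV[int]_N) : mnm_diff (mpos m) (mneg m) = m.
Proof. by apply/rowP => k; rewrite mxE !mnmE; lia. Qed.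

(** Dividing both monomials by their greatest common divisor ['X_[w]] leaves the generator attached
    to [u - v]. *)
Lemma lattice_ideal_binomial_sub rho u v :
  pc_dom rho (mnm_diff u v) -> pc_val rho (mnm_diff u v) = 1 ->
  lattice_ideal_of rho ('X_[u] - 'X_[v]).
Proof.
move=> duv ruv; pose w : 'X_{1..N} := [multinom minn (u k) (v k) | k < N].
have -> : 'X_[u] - 'X_[v] = 'X_[w] * ('X_[mpos (mnm_diff u v)] -
    pc_val rho (mnm_diff u v) *: 'X_[mneg (mnm_diff u v)]) :> {mpoly K[N]}.
  rewrite ruv scale1r mulrBr -!mpolyXD; congr ('X_[_] - 'X_[_]).
    by apply/mnmP => k; rewrite mnmDE mnm_diff_pos mnmE; lia.
  by apply/mnmP => k; rewrite mnmDE mnm_diff_neg mnmE; lia.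
apply: (idealMl (ideal_gen_ideal _)); apply: ideal_gen_sub.
by exists (mnm_diff u v).
Qed.

Lemma pc_dom_addl rho a b : pc_dom rho a -> pc_dom rho (a + b) <-> pc_dom rho b.
Proof.
move=> da; split=> [dab|db].
  by rewrite -[b](addKr a) addrC; apply: pc_domB.
rewrite -[b]opprK; apply: pc_domB => //; rewrite -sub0r.
by apply: pc_domB => //; apply: pc_dom0.
Qed.

Lemma pc_val0 rho : pc_val rho 0 = 1.
Proof.
have d0 := pc_dom0 rho.
by apply: (mulfI (pc_val_neq0 d0)); rewrite -pc_valD // addr0 mulr1.
Qed.

(* Sending [X^w] to [rho (w - v)] if [w - v] is in the lattice and to 0
   otherwise gives a linear form vanishing on the lattice ideal. *)
Lemma lattice_ideal_binomialP rho u v :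
  lattice_ideal_of rho ('X_[u] - 'X_[v]) <->
  pc_dom rho (mnm_diff u v) /\ pc_val rho (mnm_diff u v) = 1.
Proof.
split=> [Iuv|[]]; last exact: lattice_ideal_binomial_sub.
pose c w : K^o := if excluded_middle_informative (pc_dom rho (mnm_diff w v))
  then pc_val rho (mnm_diff w v) else 0.
have cE w d : pc_dom rho d -> mnm_diff w v = d -> c w = pc_val rho d.
  by move=> /[swap] <- dd; rewrite /c;
    case: excluded_middle_informative => // /(_ dd).
have cF w : ~ pc_dom rho (mnm_diff w v) -> c w = 0.
  by move=> nd; rewrite /c; case: excluded_middle_informative.
(* Asking for vanishing on all multiples [p * f] makes the set of such [f] an ideal, so only the
   generators need checking. *)
have L0 f (If : lattice_ideal_of rho f) p : monom_linext c (p * f) = 0.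
  move: f If p; pose I f := forall p, monom_linext c (p * f) = 0.
  have idI : is_ideal I.
    split=> [p|a b La Lb p|q a La p]; first by rewrite mulr0 linear0.
      by rewrite mulrDr linearD /= La Lb addr0.
    by rewrite mulrA.
  move=> f; apply: (ideal_gen_min idI) => _ [m [dm ->]] p.
  rewrite (mpolyE p) mulr_suml linear_sum big1 // => w _.
  rewrite -scalerAl mulrBr -scalerAr -!mpolyXD linearZ linearB linearZ /=.
  rewrite !monom_linextX.
  (* The two exponents differ by the lattice vector [m], so their differences with [v] are both in
     the lattice or both outside it. *)
  have wE : mnm_diff (w + mpos m)%MM v = m + mnm_diff (w + mneg m)%MM v.
    rewrite -{2}[m]mnm_diff_posneg; apply/rowP => k.
    by rewrite !mxE !mnmDE; lia.
  have [dw|ndw] := excluded_middle_informative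
      (pc_dom rho (mnm_diff (w + mneg m)%MM v)).
    rewrite (cE _ _ dw erefl) (cE _ _ _ wE); last exact/pc_dom_addl.
    by rewrite pc_valD // subrr scaler0.
  rewrite !cF //; last by rewrite wE => /(iffLR (pc_dom_addl _ dm)).
  by rewrite scaler0 subrr scaler0.
(* The form is 1 at ['X_[v]], hence also at ['X_[u]]; being nonzero there puts [u - v] in the
   lattice. *)
have := L0 _ Iuv 1; rewrite mul1r linearB /= !monom_linextX => /subr0_eq.
have vv : mnm_diff v v = 0 by apply/rowP => k; rewrite !mxE subrr.
rewrite (cE v _ (pc_dom0 rho) vv) pc_val0.
have [du|/cF ->] := excluded_middle_informative (pc_dom rho (mnm_diff u v)).
  by rewrite (cE u _ du).
by move/esym/eqP; rewrite oner_eq0.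
Qed.

End LatticeIdeals.

(** * Toric ideals and their binomials *)

Section ToricIdeals.
Variables (K : fieldType) (p q : nat) (ends : 'I_q -> 'I_p * 'I_p).

(** The degree sequence of the multigraph in which edge [k] has multiplicity [u k]. *)
Definition toric_exp (u : 'X_{1..q}) : 'X_{1..p} :=
  (\sum_(k < q) (U_((ends k).1) + U_((ends k).2)) *+ u k)%MM.

Lemma comp_toricX u :
  'X_[u] \mPo [tuple ('X_(ends k).1 * 'X_(ends k).2 : {mpoly K[p]}) | k < q] =
  'X_[toric_exp u].
Proof.
rewrite comp_mpolyX /toric_exp.
rewrite (big_morph (fun m => 'X_[m]) (@mpolyXD _ _) (@mpolyX0 _ _)).
apply: eq_bigr => k _.
by rewrite tnth_mktuple -mpolyXD mpolyXn.
Qed.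

(* [s] maps a monomial of the target to a monomial of [f] above it, if any; its
   linear extension kills the image 0 of [f], which leaves [f] as a
   combination of binomials [X^m - X^(s (toric_exp m))]. *)
Lemma toric_ideal_min (J : {mpoly K[q]} -> Prop) f : is_ideal J ->
  (forall u v, toric_exp u = toric_exp v -> J ('X_[u] - 'X_[v])) ->
  toric_ideal ends f -> J f.
Proof.
move=> idJ Jb f0.
(* The default [0%MM] is harmless: below, [s] is evaluated only at [toric_exp m] with [m] in the
   support of [f]. *)
pose s w := nth 0%MM (msupp f) (find (fun u => toric_exp u == w) (msupp f)).
have sE m : m \in msupp f -> toric_exp (s (toric_exp m)) = toric_exp m.
  move=> fm; apply/eqP; pose P u := toric_exp u == toric_exp m.
  by apply: (@nth_find _ 0%MM P); apply/hasP; exists m; rewrite // /P.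
pose c w : {mpoly K[q]} := 'X_[s w].
have := congr1 (monom_linext c) f0.
rewrite linear0 comp_mpolyEX linear_sum => fs0.
rewrite -[f]subr0 -[X in _ - X]fs0 {1}(mpolyE f) -sumrB big_seq.
apply: ideal_bigsum => // m fm; rewrite linearZ /= comp_toricX monom_linextX.
rewrite -scalerBr -mul_mpolyC; apply: idealMl => //; apply: Jb.
by rewrite sE.
Qed.

End ToricIdeals.

(** * Rearranging monomials modulo minors *)

Lemma sum_nat_eq_lt (I : finType) (P : pred I) (a b : I -> nat) i :
  (\sum_(k | P k) a k = \sum_(k | P k) b k)%N -> P i -> (b i < a i)%N ->
  exists2 j, P j & (a j < b j)%N.
Proof.
move=> eq_ab Pi lt_ba; apply/exists_inP; apply: contraT.
rewrite negb_exists_in => /forall_inP le_ba.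
have: (\sum_(k | P k) b k < \sum_(k | P k) a k)%N; last by rewrite eq_ab ltnn.
rewrite (bigD1 i) // [X in (_ < X)%N](bigD1 i) //= -addSn leq_add //.
by apply: leq_sum => k /andP[/le_ba]; rewrite -leqNgt.
Qed.

Section Rearrangement.
Variables (K : fieldType) (n : nat).
Local Notation S := {mpoly K[n + n]}.

Definition minor (i j : 'I_n) : S := xvar K i * yvar K j - xvar K j * yvar K i.

Lemma minor0 i : minor i i = 0. Proof. exact: subrr. Qed.

Lemma minorE i j : minor i j =
  'X_[U_(lshift n i) + U_(rshift n j)] - 'X_[U_(lshift n j) + U_(rshift n i)].
Proof. by rewrite !mpolyXD. Qed.

Variables (J : S -> Prop) (r : rel 'I_n).
Hypotheses (idJ : is_ideal J) (r_refl : reflexive r).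
Hypotheses (r_sym : ssrbool.symmetric r) (r_trans : transitive r).
Hypothesis Jr : forall i j, r i j -> J (minor i j).

Lemma sum_indicator (P : pred 'I_n) i :
  (\sum_(k | P k) (i == k : nat) = P i)%N.
Proof.
rewrite big_mkcond (bigD1 i) //= eqxx big1 ?addn0; first by case: (P i).
by move=> k; rewrite eq_sym => /negbTE ->; case: ifP.
Qed.

(** Induction on the total excess of the x-exponents of [u] over those of [v]: each exchange of x_i
    y_j for x_j y_i lowers it and changes ['X_[u]] by a multiple of [minor i j]. *)
Lemma rearrangement (u v : 'X_{1..n + n}) :
  (forall i, u (lshift n i) + u (rshift n i)
             = v (lshift n i) + v (rshift n i))%N ->
  (forall i, \sum_(j | r i j) u (lshift n j)
             = \sum_(j | r i j) v (lshift n j))%N ->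
  J ('X_[u] - 'X_[v]).
Proof.
have [d] := ubnP (\sum_i (u (lshift n i) - v (lshift n i)))%N.
elim: d u => // d IHd u; rewrite ltnS => le_d uvV uvr.
have [/existsP[i lt_vu]|] :=
  boolP [exists i, v (lshift n i) < u (lshift n i)]%N; last first.
  (* Without excess, equal class sums force equal x-exponents, and the vertex degrees then fix the
     y-exponents. *)
  rewrite negb_exists => /forallP le_uv.
  suff -> : u = v by rewrite subrr; apply: ideal0.
  have eq_l k : u (lshift n k) = v (lshift n k).
    apply/eqP; rewrite eqn_leq leqNgt le_uv leqNgt /=; apply/negP => lt_uv.
    have [j _] := sum_nat_eq_lt (esym (uvr k)) (r_refl k) lt_uv.
    by rewrite (negbTE (le_uv j)).
  apply/mnmP => k; rewrite -(splitK k); case: (split k) => k' //=.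
  by have := uvV k'; rewrite eq_l => /addnI.
(* An excess at [i] is balanced by a deficit at some [j] of the same class. *)
have [j rij lt_uv] := sum_nat_eq_lt (uvr i) (r_refl i) lt_vu.
have neq_ij : i != j by apply: contraTneq lt_uv => <-; rewrite -leqNgt ltnW.
pose a : 'X_{1..n + n} := (U_(lshift n i) + U_(rshift n j))%MM.
pose b : 'X_{1..n + n} := (U_(lshift n j) + U_(rshift n i))%MM.
have ax k : a (lshift n k) = (i == k).
  by rewrite mnmDE !mnm1E eq_lshift eq_rlshift addn0.
have ay k : a (rshift n k) = (j == k).
  by rewrite mnmDE !mnm1E eq_lrshift eq_rshift.
have bx k : b (lshift n k) = (j == k).
  by rewrite mnmDE !mnm1E eq_lshift eq_rlshift addn0.
have by' k : b (rshift n k) = (i == k).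
  by rewrite mnmDE !mnm1E eq_lrshift eq_rshift.
(* x_i divides ['X_[u]] by the excess at [i]; y_j does because the degree at [j] agrees with that of
   [v] while the x-exponent is smaller. *)
have le_au : (a <= u)%MM.
  apply/mnm_lepP => k; rewrite -(splitK k); case: (split k) => k' /=.
    by rewrite ax; case: eqP => // <-; lia.
  by rewrite ay; case: eqP => // <-; have := uvV j; lia.
have uE k : (u k = (u - a)%MM k + a k)%N.
  by rewrite -mnmDE submK.
have -> : 'X_[u] - 'X_[v] =
    'X_[u - a] * minor i j + ('X_[u - a + b] - 'X_[v]) :> S.
  by rewrite minorE mulrBr -!mpolyXD submK // addrA subrK.
apply: idealD => //; first by apply: idealMl => //; apply: Jr.
clearbody a b; apply: IHd => [|k|k].
(* The excess drops by one at [i]; at [j] it stays 0, since the x-exponent there was strictly below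
   that of [v]. *)
- apply: leq_trans le_d; rewrite (bigD1 i) // [X in (_ < X)%N](bigD1 i) //=.
  rewrite -addSn leq_add //.
    rewrite mnmDE bx eq_sym (negbTE neq_ij) addn0.
    by have := uE (lshift n i); rewrite ax eqxx; lia.
  apply: leq_sum => k; rewrite eq_sym => /negbTE neq_ik.
  have := uE (lshift n k); rewrite mnmDE ax bx neq_ik.
  by case: eqP => [<-|_]; lia.
- have := uE (lshift n k); have := uE (rshift n k).
  by rewrite !mnmDE ax bx ay by' -uvV; lia.
(* As [r i j] holds, the class of [k] contains both [i] and [j] or neither. *)
- rewrite -uvr; under eq_bigr do rewrite mnmDE bx.
  under [RHS]eq_bigr do rewrite uE ax.
  rewrite !big_split !sum_indicator /=; congr (_ + nat_of_bool _)%N.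
  by apply/idP/idP => [rkj|rki]; [apply: r_trans rkj _; rewrite r_sym
                                 |apply: r_trans rki _].
Qed.

End Rearrangement.

(** * The toric ideal of the complete bipartite graph *)

Section CompleteBipartiteToric.
Variables (K : fieldType) (m : nat).

Lemma K2_ends_l (i : 'I_m) :
  K2_ends (lshift m i) = (lshift m (0 : 'I_2), rshift 2 i).
Proof. by rewrite /K2_ends (unsplitK (inl i)). Qed.

Lemma K2_ends_r (i : 'I_m) :
  K2_ends (rshift m i) = (lshift m (1 : 'I_2), rshift 2 i).
Proof. by rewrite /K2_ends (unsplitK (inr i)). Qed.

Lemma toric_exp_K2_part (u : 'X_{1..m + m}) (i : 'I_m) :
  (toric_exp (@K2_ends m) u (rshift 2 i) = u (lshift m i) + u (rshift m i))%N.
Proof.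
rewrite mnm_sumE big_split_ord /=.
by congr addn; rewrite (bigD1 i) //= big1 => [|j];
  rewrite ?(K2_ends_l, K2_ends_r) mulmnE mnmDE !mnm1E eq_lrshift eq_rshift
    ?eqxx ?addn0 ?mul1n // => /negbTE ->.
Qed.

Lemma toric_exp_K2_s1 (u : 'X_{1..m + m}) :
  (toric_exp (@K2_ends m) u (lshift m (0%R : 'I_2)) =
   \sum_i u (lshift m i))%N.
Proof.
rewrite mnm_sumE big_split_ord /= [X in (_ + X)%N]big1 ?addn0 => [|i _].
  apply: eq_bigr => i _.
  by rewrite K2_ends_l mulmnE mnmDE !mnm1E eqxx eq_rlshift mul1n.
by rewrite K2_ends_r mulmnE mnmDE !mnm1E eq_lshift eq_rlshift.
Qed.

Lemma toric_K2_has_minor i j : toric_ideal (@K2_ends m) (minor K i j).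
Proof.
rewrite /toric_ideal rmorphB !rmorphM /= !comp_mpolyXU -!tnth_nth !tnth_mktuple.
rewrite !K2_ends_l !K2_ends_r /=.
by rewrite mulrACA [X in _ - X]mulrACA [X in _ - _ * X]mulrC subrr.
Qed.

(** Equal degrees at the t_i and at s_1 are the two hypotheses of [rearrangement] for the relation
    with a single class. *)
Lemma toric_K2_min (J : {mpoly K[m + m]} -> Prop) f : is_ideal J ->
  (forall i j, J (minor K i j)) -> toric_ideal (@K2_ends m) f -> J f.
Proof.
move=> idJ Jm; apply: toric_ideal_min => // u v uv.
apply: (rearrangement (r := fun _ _ => true)) => // i.
  by rewrite -!toric_exp_K2_part uv.
by rewrite -!toric_exp_K2_s1 uv.
Qed.

End CompleteBipartiteToric.

(** * Minors in binomial edge ideals and component ideals *)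

Section BinomialEdgeIdeals.
Variables (K : fieldType) (n : nat).
Implicit Types (e : rel 'I_n) (C : {set 'I_n}) (i j : 'I_n).
Local Notation S := {mpoly K[n + n]}.

Definition comp_K2 C : {mpoly K[#|C| + #|C|]} -> S :=
  fun g => g \mPo [tuple K2_edge_var K k | k < #|C| + #|C|].

Lemma comp_K2_minor C (a b : 'I_#|C|) :
  comp_K2 (minor K a b) = minor K (enum_val a) (enum_val b).
Proof.
rewrite /comp_K2 rmorphB !rmorphM /= !comp_mpolyXU -!tnth_nth !tnth_mktuple.
by rewrite /K2_edge_var !(unsplitK (inl _)) !(unsplitK (inr _)).
Qed.

Lemma toric_K2_ideal_minor C i j :
  i \in C -> j \in C -> toric_K2_ideal K C (minor K i j).
Proof.
move=> Ci Cj; apply: ideal_gen_sub.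
exists (minor K (enum_rank_in Ci i) (enum_rank_in Ci j)).
split; first exact: toric_K2_has_minor.
by rewrite -/(comp_K2 _) comp_K2_minor !enum_rankK_in.
Qed.

(** Together with [toric_K2_ideal_minor], this identifies the extended toric ideal with the ideal of
    all minors on [C]. The proof pulls [I] back along the renaming of variables. *)
Lemma toric_K2_ideal_min C (I : S -> Prop) f : is_ideal I ->
  (forall i j, i \in C -> j \in C -> I (minor K i j)) ->
  toric_K2_ideal K C f -> I f.
Proof.
move=> idI Im; apply: ideal_gen_min => // _ [g [g0 ->]].
apply: (toric_K2_min (J := fun g => I (comp_K2 g))) g0.
  exact: ideal_preim.
by move=> a b; rewrite comp_K2_minor; apply: Im; apply: enum_valP.
Qed.

Lemma binomial_edge_ideal_minor e i j :
  e i j -> binomial_edge_ideal K e (minor K i j).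
Proof. by move=> eij; apply: ideal_gen_sub; exists i, j. Qed.

Lemma binomial_edge_ideal_min e (I : S -> Prop) f : is_ideal I ->
  (forall i j, e i j -> I (minor K i j)) -> binomial_edge_ideal K e f -> I f.
Proof.
by move=> idI Im; apply: ideal_gen_min => // _ [i [j [/Im Iij ->]]].
Qed.

(* Evaluate at the point with x_i = y_j = 1 and all other coordinates 0: the
   only minors that do not vanish there are those of the pair {i, j}. *)
Lemma minor_in_edge_ideal e i j :
  binomial_edge_ideal K e (minor K i j) -> i != j -> e i j || e j i.
Proof.
move=> Jij neq_ij; apply: contraT; rewrite negb_or => /andP[nij nji].
pose pt (k : 'I_(n + n)) : K :=
  match split k with inl a => (a == i)%:R | inr b => (b == j)%:R end.
have ptE a b : (minor K a b).@[pt] =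
    ((a == i) && (b == j))%:R - ((b == i) && (a == j))%:R.
  rewrite rmorphB !rmorphM /= !mevalXU /pt.
  by rewrite !(unsplitK (inl _)) !(unsplitK (inr _)) -!natrM !mulnb.
suff : (minor K i j).@[pt] = 0.
  by rewrite ptE !eqxx eq_sym (negbTE neq_ij) subr0 => /eqP; rewrite oner_eq0.
pose ev : {rmorphism S -> K} := meval pt.
have id0 : is_ideal (fun c : K => c = 0).
  by split=> [|a b -> ->|p a ->]; rewrite ?addr0 ?mulr0.
apply: (binomial_edge_ideal_min (ideal_preim ev id0)) Jij => a b eab /=.
rewrite ptE; case: andP => [[/eqP ai /eqP bj]|_].
  by rewrite ai bj (negbTE nij) in eab.
case: andP => [[/eqP bi /eqP aj]|_]; last by rewrite subrr.
by rewrite bi aj (negbTE nji) in eab.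
Qed.

Definition complete_components e :=
  forall i j, connect e i j -> i != j -> e i j.

Lemma componentsP e C :
  reflect (exists i, C = [set j | connect e i j]) (C \in components e).
Proof.
apply: (iffP imsetP) => [[i _ ->]|[i ->]]; exists i => //;
  by apply/setP => j; rewrite !inE.
Qed.

Lemma connect_in_component e C i j : ssrbool.symmetric e ->
  C \in components e -> i \in C -> j \in C -> connect e i j.
Proof.
move=> e_sym /componentsP[k ->]; rewrite !inE => ki; apply: connect_trans.
by rewrite sym_connect_sym.
Qed.

(** An edge from [i] lies inside the component of [i], so both sides have the same generating
    minors. *)
Lemma binomial_edge_ideal_components e :
  ideal_eq (binomial_edge_ideal K e)
    (ideal_gen (fun f => exists C : {set 'I_n},
       C \in components e /\ binomial_edge_ideal K (induced e C) f)).
Proof.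
move=> f; split.
  apply: binomial_edge_ideal_min => [|i j eij]; first exact: ideal_gen_ideal.
  apply: ideal_gen_sub; exists [set k | connect e i k].
  split; first by apply/componentsP; exists i.
  apply: binomial_edge_ideal_minor.
  by rewrite /induced /= !inE connect0 connect1 ?eij.
apply: ideal_gen_min => [|g [C [_]]]; first exact: ideal_gen_ideal.
apply: binomial_edge_ideal_min => [|i j /and3P[_ _]].
  exact: ideal_gen_ideal.
exact: binomial_edge_ideal_minor.
Qed.

Lemma ideal_gen_sum (T : finType) (D : {set T}) (I I' : T -> S -> Prop) :
  (forall t, t \in D -> is_ideal (I' t)) ->
  (forall t, t \in D -> ideal_eq (I t) (I' t)) ->
  ideal_eq (ideal_gen (fun f => exists t, t \in D /\ I t f)) (ideal_sum D I').
Proof.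
move=> idI' eqI f; split.
  apply: ideal_gen_min => [|g [t [Dt /(eqI t Dt) Itg]]].
    exact: ideal_sum_ideal.
  exact: ideal_sum_sub Itg.
move=> [g [Ig ->]]; apply: ideal_bigsum => [|t Dt].
  exact: ideal_gen_ideal.
by apply: ideal_gen_sub; exists t; split=> //; apply/eqI/Ig.
Qed.

(** * Complete components against the toric and lattice conditions *)

Section Graph.
Variable e : rel 'I_n.
Hypothesis e_sym : ssrbool.symmetric e.

Lemma complete_components_toric : complete_components e ->
  forall C, C \in components e ->
    ideal_eq (binomial_edge_ideal K (induced e C)) (toric_K2_ideal K C).
Proof.
move=> e_compl C eC f; split.
  apply: binomial_edge_ideal_min => [|i j /and3P[Ci Cj _]].
    exact: ideal_gen_ideal.
  exact: toric_K2_ideal_minor.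
apply: toric_K2_ideal_min => [|i j Ci Cj]; first exact: ideal_gen_ideal.
have [->|neq_ij] := eqVneq i j.
  by rewrite minor0; apply: ideal0; apply: ideal_gen_ideal.
apply: binomial_edge_ideal_minor; rewrite /induced /= Ci Cj e_compl //.
exact: connect_in_component Ci Cj.
Qed.

(** The toric ideal contains the minor of any two vertices of a component, and [minor_in_edge_ideal]
    turns that minor into an edge. *)
Lemma toric_complete_components :
  (forall C, C \in components e ->
    ideal_eq (binomial_edge_ideal K (induced e C)) (toric_K2_ideal K C)) ->
  complete_components e.
Proof.
move=> eqJT i j eij neq_ij; pose C := [set k | connect e i k].
have eC : C \in components e by apply/componentsP; exists i.
have: binomial_edge_ideal K (induced e C) (minor K i j).
  by apply/(eqJT C eC)/toric_K2_ideal_minor; rewrite inE.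
move=> /minor_in_edge_ideal/(_ neq_ij)/orP[]/and3P[_ _] //.
by rewrite e_sym.
Qed.

Lemma lattice_complete_components :
  is_lattice_ideal (binomial_edge_ideal K e) -> complete_components e.
Proof.
move=> [rho eqJL].
pose a i j : 'X_{1..n + n} := (U_(lshift n i) + U_(rshift n j))%MM.
have JP i j : binomial_edge_ideal K e (minor K i j) <->
    pc_dom rho (mnm_diff (a i j) (a j i)) /\
    pc_val rho (mnm_diff (a i j) (a j i)) = 1.
  by rewrite minorE; apply: iff_trans (lattice_ideal_binomialP _ _ _).
(* Exponent differences of minors add up along i, j, k; this is what makes membership of minors
   transitive. *)
have aD i j k : mnm_diff (a i k) (a k i) =
    mnm_diff (a i j) (a j i) + mnm_diff (a j k) (a k j).
  by apply/rowP => t; rewrite !mxE !mnmDE; lia.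
move=> i j /connectP[s + ->].
suff Js k : path e k s -> binomial_edge_ideal K e (minor K k (last k s)).
  move=> /Js /minor_in_edge_ideal e_ij /e_ij.
  by rewrite (e_sym (last i s)) orbb.
elim: s k => [|k s IHs] i' /=.
  by move=> _; rewrite minor0; apply: ideal0; apply: ideal_gen_ideal.
move=> /andP[/binomial_edge_ideal_minor/JP[d1 r1] /IHs/JP[d2 r2]].
apply/JP; rewrite (aD _ k); split; first exact/pc_dom_addl.
by rewrite pc_valD // r1 r2 mulr1.
Qed.

(** Differences of exponents that agree in the two invariants of [rearrangement] for [connect e]. *)
Definition component_lattice (m : 'rV[int]_(n + n)) : Prop :=
  (forall i, m 0 (lshift n i) + m 0 (rshift n i) = 0) /\
  (forall i, \sum_(j | connect e i j) m 0 (lshift n j) = 0).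

Lemma component_lattice0 : component_lattice 0.
Proof.
by split=> i; [rewrite !mxE | rewrite big1 // => j _; rewrite mxE].
Qed.

Lemma component_latticeB a b :
  component_lattice a -> component_lattice b -> component_lattice (a - b).
Proof.
move=> [a1 a2] [b1 b2]; split=> i.
  by rewrite !mxE addrACA -opprD a1 b1 subrr.
rewrite (eq_bigr (fun j => a 0 (lshift n j) - b 0 (lshift n j))).
  by rewrite sumrB a2 b2 subrr.
by move=> j _; rewrite !mxE.
Qed.

Definition component_character : partial_character K (n + n) :=
  @PartialCharacter K (n + n) component_lattice (fun=> 1)
    component_lattice0 component_latticeB
    (fun _ _ => oner_neq0 K) (fun _ _ _ _ => esym (mulr1 1)).

Lemma complete_components_lattice :
  complete_components e -> is_lattice_ideal (binomial_edge_ideal K e).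
Proof.
move=> e_compl; exists component_character => f; split.
  apply: binomial_edge_ideal_min => [|i j eij]; first exact: ideal_gen_ideal.
  rewrite minorE; apply: lattice_ideal_binomial_sub => //; split=> k.
    rewrite !mxE !mnmDE !mnm1E !eq_lshift !eq_rshift !eq_lrshift !eq_rlshift.
    by case: (i == k); case: (j == k).
  rewrite (eq_bigr (fun t => (i == t)%:Z - (j == t)%:Z)); last first.
    by move=> t _; rewrite !mxE !mnmDE !mnm1E !eq_lshift !eq_rlshift !addn0.
  rewrite sumrB -!(big_morph Posz PoszD (erefl _)) !sum_indicator.
  (* The x-part of the difference is the unit vector at [i] minus that at [j], and the edge puts
     both in the same component. *)
  suff -> : connect e k i = connect e k j by rewrite subrr.
  by apply/idP/idP => ke; apply: connect_trans ke _; rewrite connect1 // e_sym.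
apply: ideal_gen_min => [|_ [m [[m1 m2] ->]]]; first exact: ideal_gen_ideal.
(* The character is trivial, so each generator is a difference of two monomials. *)
rewrite scale1r; apply: (rearrangement (r := connect e)) => //.
- exact: ideal_gen_ideal.
- exact: sym_connect_sym.
- exact: connect_trans.
- move=> i j ij; have [->|neq_ij] := eqVneq i j.
    by rewrite minor0; apply: ideal0; apply: ideal_gen_ideal.
  exact/binomial_edge_ideal_minor/e_compl.
- by move=> i; have := m1 i; rewrite !mnmE; lia.
- move=> i; apply/eqP; rewrite -eqz_nat !(big_morph Posz PoszD (erefl _)).
  rewrite -subr_eq0 -sumrB; apply/eqP; rewrite -[RHS](m2 i).
  apply: eq_bigr => j _.
  by rewrite !mnmE; lia.
Qed.

End Graph.
End BinomialEdgeIdeals.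

Theorem theorem3p2 (K : fieldType) (n : nat) (e : rel 'I_n)
  (e_sym : ssrbool.symmetric e) (e_irr : irreflexive e) :
  is_lattice_ideal (binomial_edge_ideal K e) <->
  [/\ ideal_eq (binomial_edge_ideal K e)
        (ideal_gen (fun f => exists C : {set 'I_n},
           C \in components e /\ binomial_edge_ideal K (induced e C) f)),
      ideal_eq
        (ideal_gen (fun f => exists C : {set 'I_n},
           C \in components e /\ binomial_edge_ideal K (induced e C) f))
        (ideal_sum (components e) (toric_K2_ideal K))
    & forall C : {set 'I_n}, C \in components e ->
        ideal_eq (binomial_edge_ideal K (induced e C))
                 (toric_K2_ideal K C)].
Proof.
split=> [Jlat|[_ _ eqJT]]; last first.
  apply: complete_components_lattice => //.
  exact: toric_complete_components eqJT.
have e_compl := lattice_complete_components e_sym Jlat.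
have eqJT := complete_components_toric (K := K) e_sym e_compl.
split=> //; first exact: binomial_edge_ideal_components.
by apply: ideal_gen_sum => // C _; apply: ideal_gen_ideal.
Qed.
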